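(* Let $I\subset(0,\infty)$ be an interval, let $f:I\to\mathbb{R}$ be differentiable on $I^{\circ}$, and let $a,b\in I$ with $a<b$, where $f'$ exists at every point of $[a,b]$ (one-sided derivative at $a$ or $b$ if that point is an endpoint of $I$), and $f'\in L[a,b]$. Let $q>1$, $\frac1p+\frac1q=1$, and suppose $|f'|^q$ is harmonically convex on $[a,b]$. Then for every $\lambda\in[0,1]$ $$\left|(1-\lambda) f\left(\frac{2ab}{a+b}\right)+\lambda\,\frac{f(a)+f(b)}{2}-\frac{ab}{b-a}\int_a^b\frac{f(x)}{x^2}\,dx\right|$$ $$\le\frac{ab(b-a)}{2}\left\{C_1(\lambda,p;a,b)^{\frac1p}\left(\frac{\left|f'\left(\frac{2ab}{a+b}\right)\right|^q+|f'(b)|^q}{4}\right)^{\frac1q}+C_1(\lambda,p;b,a)^{\frac1p}\left(\frac{\left|f'\left(\frac{2ab}{a+b}\right)\right|^q+|f'(a)|^q}{4}\right)^{\frac1q}\right\},$$ where, for $u,\vartheta>0$, $$C_1(\lambda,p;u,\vartheta)=\int_0^{1/2}\frac{|\lambda-2t|^p}{(t\vartheta+(1-t)u)^{2p}}\,dt.$$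
   Context: A function $g:J\to\mathbb{R}$ on an interval $J\subset\mathbb{R}\setminus\{0\}$ is harmonically convex if $g\left(\frac{xy}{tx+(1-t)y}\right)\le t\,g(y)+(1-t)\,g(x)$ for all $x,y\in J$ and $t\in[0,1]$. $L[a,b]$ denotes the Lebesgue integrable functions on $[a,b]$. *)

(* Defs.v *)
From HB Require Import structures.
From mathcomp Require Import all_boot all_order all_algebra.
From mathcomp Require Import all_classical all_reals all_analysis.

Set Implicit Arguments.
Unset Strict Implicit.
Unset Printing Implicit Defensive.

Import Order.TTheory GRing.Theory Num.Theory.
Import numFieldNormedType.Exports.

Local Open Scope classical_set_scope.
Local Open Scope ring_scope.

Definition harmonically_convex (R : realType) (J : set R) (g : R -> R) : Prop :=
  [/\ is_interval J, ~ J 0 &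
      forall x y t, J x -> J y -> 0 <= t <= 1 ->
        g (x * y / (t * x + (1 - t) * y)) <= t * g y + (1 - t) * g x].

(* Derivative of the restriction of f to I: only values of f on I matter.  For
   an interval I it is the usual derivative at interior points of I and the
   one-sided derivative at an endpoint of I belonging to I. *)
Definition derivable_on (R : realType) (I : set R) (f : R -> R) (x : R) : Prop :=
  cvg ((f y - f x) / (y - x) @[y --> within I x^']).

Definition derive_on (R : realType) (I : set R) (f : R -> R) (x : R) : R :=
  lim ((f y - f x) / (y - x) @[y --> within I x^']).

Definition C1 (R : realType) (lam p u v : R) : R :=
  \int[lebesgue_measure]_(t in `[0, 1 / 2])
    (`|lam - 2 * t| `^ p / (t * v + (1 - t) * u) `^ (2 * p)).

(* Main.v *)
Require Import Defs.
From HB Require Import structures.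
From mathcomp Require Import all_boot all_order all_algebra.
From mathcomp Require Import all_classical all_reals all_analysis.
From mathcomp Require Import ring lra.

(* With phi(s) = u v / (s v + (1 - s) u) and G a primitive of f(x) / x^2, the
   function
     E(s) = (lam - 2 s) f(phi(s)) / (u v (v - u)) - 2 G(phi(s)) / (v - u)^2
   has derivative - (lam - 2 s) f'(phi(s)) / (s v + (1 - s) u)^2 on [0, 1/2],
   and its increments for (u, v) = (a, b) and (u, v) = (b, a) combine into the
   left-hand side of the theorem.  Neither the fundamental theorem of calculus
   for f' nor the measurability of f' o phi is needed: for every k > 0, Young's
   inequality and harmonic convexity bound |E'| by
     k^p X^p / p + k^(-q) m / q,
   where X(s) = |lam - 2 s| / (s v + (1 - s) u)^2 and m is affine.  This bound
   is continuous, hence has a primitive, and the mean value inequality bounds the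
   increment of E by the increment of that primitive.  Optimising over k gives
   the Hoelder form. *)

Set Implicit Arguments.
Unset Strict Implicit.
Unset Printing Implicit Defensive.

Import Order.TTheory GRing.Theory Num.Theory.
Import numFieldNormedType.Exports.

Local Open Scope classical_set_scope.
Local Open Scope ring_scope.

(** * Continuity of powers and of compositions on a set *)

(** Away from 0 the power is differentiable; at 0, a bound [e] on the value is met by the radius
    [e ^ (1/r)]. The case 0 matters because [lam - 2 s] may vanish inside [[0, 1/2]]. *)
Lemma continuous_normr_powR (R : realType) (r : R) :
  0 < r -> continuous (fun y : R => `|y| `^ r).
Proof.
move=> r0 y; have [->|y0] := eqVneq y 0.
  rewrite /continuous_at normr0 powR0 ?gt_eqF//.
  apply/cvgrPdist_lt => e e0; near=> z.
  rewrite sub0r normrN ger0_norm ?powR_ge0//.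
  have -> : e = (e `^ r^-1) `^ r.
    by rewrite -powRrM mulVf ?gt_eqF// powRr1// ltW.
  apply: gt0_ltr_powR; rewrite ?nnegrE ?powR_ge0//.
  near: z; apply: (@cvgr0_norm_lt _ _ _ _ _ (@idfun R)); first exact: cvg_id.
  exact: powR_gt0.
have cpow : {for `|y|, continuous ((@powR R) ^~ r)}.
  apply/differentiable_continuous/derivable1_diffP; apply: derivable_powR.
  by rewrite in_itv/= andbT normr_gt0.
exact: (continuous_comp (@norm_continuous _ _ y) cpow).
Unshelve. all: by end_near. Qed.

Lemma within_continuous_comp_in (T U V : topologicalType) (A : set T)
    (B : set U) (phi : T -> U) (g : U -> V) :
  (forall x, A x -> B (phi x)) -> {within A, continuous phi} ->
  {within B, continuous g} -> {within A, continuous (g \o phi)}.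
Proof.
move=> AB /subspace_continuousP cphi /subspace_continuousP cg.
apply/subspace_continuousP => x Ax P /(cg _ (AB _ Ax)) gP.
have := cphi _ Ax _ gP; rewrite !nbhs_simpl /= /within /= => H.
by apply: filterS H => z Hz Az; apply: Hz => //; exact: AB.
Qed.

(** * Optimising Young's inequality over the scaling parameter *)

(** If [z] were positive, the [l] with [l ^ r = z / (D + 1)] would give [z <= z D / (D + 1) < z].
    This serves the degenerate cases of the optimisation, where the infimum 0 need not be
    attained. *)
Lemma le_powR_mul_inf (R : realType) (r z D : R) : 0 < r -> 0 <= D ->
  (forall l, 0 < l -> z <= l `^ r * D) -> z <= 0.
Proof.
move=> r0 D0 H; rewrite leNgt; apply/negP => z0.
have D1 : 0 < D + 1 by lra.
have zD : 0 < z / (D + 1) by rewrite divr_gt0.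
have := H _ (powR_gt0 r^-1 zD).
rewrite -powRrM mulVf ?gt_eqF// powRr1 ?(ltW zD)//.
rewrite mulrAC ler_pdivlMr//; nra.
Qed.

(** For [C] and [D] positive the right-hand side is the minimum over [k], reached when the two
    powers balance. If [C = 0] one lets [k] tend to infinity, and if [D = 0] one lets [k] tend to
    0. *)
Lemma le_young_inf (R : realType) (p q z C D : R) :
  0 < p -> 0 < q -> p^-1 + q^-1 = 1 -> 0 <= C -> 0 <= D ->
  (forall k, 0 < k -> z <= k `^ p / p * C + k^-1 `^ q / q * D) ->
  z <= C `^ p^-1 * D `^ q^-1.
Proof.
move=> p0 q0 pq; rewrite le_eqVlt => /predU1P[<- D0 H|C0].
  rewrite powR0 ?gt_eqF ?invr_gt0// mul0r.
  apply: (@le_powR_mul_inf _ q _ (q^-1 * D)) => //.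
    by rewrite mulr_ge0// invr_ge0 ltW.
  move=> l l0; have := H l^-1; rewrite invr_gt0 invrK mulr0 add0r mulrA; exact.
rewrite le_eqVlt => /predU1P[<- H|D0 H].
  rewrite [X in _ * X]powR0 ?gt_eqF ?invr_gt0// mulr0.
  apply: (@le_powR_mul_inf _ p _ (p^-1 * C)) => //.
    by rewrite mulr_ge0 ?invr_ge0 ?ltW.
  by move=> l l0; have := H l l0; rewrite mulr0 addr0 mulrA.
have CE : C = (C `^ p^-1) `^ p by rewrite -powRrM mulVf ?gt_eqF// powRr1// ltW.
have DE : D = (D `^ q^-1) `^ q by rewrite -powRrM mulVf ?gt_eqF// powRr1// ltW.
have x0 := powR_gt0 p^-1 C0; have y0 := powR_gt0 q^-1 D0.
move: H; rewrite {1}CE {1}DE.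
set x := C `^ _ in x0 *; set y := D `^ _ in y0 * => H.
have T0 : 0 < x * y by rewrite mulr_gt0.
(* This k makes (k x)^p and (y / k)^q both equal to x y. *)
have k0 : 0 < (x * y) `^ p^-1 / x by rewrite divr_gt0// powR_gt0.
apply: le_trans (H _ k0) _.
rewrite mulrAC -powRM ?(ltW k0) ?(ltW x0)// divfK ?gt_eqF//.
rewrite [X in _ + X]mulrAC -powRM ?invr_ge0 ?(ltW k0) ?(ltW y0)//.
rewrite invf_div mulrAC.
have -> : x * y / (x * y) `^ p^-1 = (x * y) `^ q^-1.
  have -> : q^-1 = 1 - p^-1 by lra.
  by rewrite powRB ?(gt_eqF T0) ?implybT// powRr1// ltW.
rewrite -!powRrM !mulVf ?gt_eqF// powRr1 ?(ltW T0)// -mulrDr pq mulr1//.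
Qed.

(** * Mean value inequality and a Hoelder bound for increments *)

(** Both [N - E] and [N + E] have nonnegative derivative, so the mean value theorem makes both
    increments nonnegative. *)
Lemma increment_le (R : realType) (E N : R -> R) (dE dN : R -> R) (a b : R) :
  a < b ->
  {within `[a, b], continuous E} -> {within `[a, b], continuous N} ->
  (forall s, a < s < b -> is_derive s 1 E (dE s)) ->
  (forall s, a < s < b -> is_derive s 1 N (dN s)) ->
  (forall s, a < s < b -> `|dE s| <= dN s) ->
  `|E b - E a| <= N b - N a.
Proof.
move=> ab cE cN hE hN le.
have [c + Hc] : exists2 c, c \in `]a, b[%R &
    (N - E) b - (N - E) a = (dN - dE) c * (b - a).
  apply: MVT => //; last exact: within_continuousB.
  move=> x; rewrite in_itv/= => xab.
  by apply: is_deriveB; [exact: hN|exact: hE].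
have [d + Hd] : exists2 d, d \in `]a, b[%R &
    (N + E) b - (N + E) a = (dN + dE) d * (b - a).
  apply: MVT => //; last exact: within_continuousD.
  move=> x; rewrite in_itv/= => xab.
  by apply: is_deriveD; [exact: hN|exact: hE].
rewrite !in_itv/= => /le + /le; rewrite !ler_norml => /andP[H1 H2] /andP[H3 H4].
have : 0 <= (dN - dE) c * (b - a) by rewrite mulr_ge0 ?subr_ge0 ?(ltW ab).
have : 0 <= (dN + dE) d * (b - a).
  rewrite mulr_ge0 ?subr_ge0 ?(ltW ab)//.
  rewrite [X in _ <= X](_ : _ = dN d + dE d)//; lra.
rewrite -Hc -Hd.
have -> : (N + E) b - (N + E) a = N b + E b - (N a + E a) by [].
have -> : (N - E) b - (N - E) a = N b - E b - (N a - E a) by [].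
lra.
Qed.

Lemma is_derive_primitive (R : realType) (g : R -> R) (a b x : R) :
  a < x < b -> {within `[a, b], continuous g} ->
  is_derive x 1 (fun y => \int[lebesgue_measure]_(t in `[a, y]) g t) (g x).
Proof.
move=> /andP[ax xb] cg; have ab := lt_trans ax xb.
have ig : lebesgue_measure.-integrable `[a, b] (EFin \o g).
  by apply: continuous_compact_integrable => //; exact: segment_compact.
have cgx : {for x, continuous g}.
  by apply: within_continuous_continuous cg _ => //; rewrite in_itv/= ax.
have [dP PE] := continuous_FTC1_closed xb ig ax cgx.
by apply: DeriveDef => //; rewrite -derive1E.
Qed.

Lemma within_continuous_primitive (R : realType) (g : R -> R) (a b : R) :
  a <= b -> {within `[a, b], continuous g} ->
  {within `[a, b], continuous
    (fun y => \int[lebesgue_measure]_(t in `[a, y]) g t)}.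
Proof.
move=> ab cg; apply: (parameterized_integral_continuous ab).
by apply: continuous_compact_integrable => //; exact: segment_compact.
Qed.

Lemma within_continuousM (T : topologicalType) (K : numFieldType)
    (A : set T) (f g : T -> K) :
  {within A, continuous f} -> {within A, continuous g} ->
  {within A, continuous (f * g)}.
Proof. by move=> cf cg x; apply: cvgM; [exact: cf|exact: cg]. Qed.

(** Hoelder's inequality in which [M b - M a] stands in for the integral of [Y ^ q]. Splitting [X Y]
    as [(k X) (Y / k)], Young's inequality bounds [|dE|] by the derivative of [N]; [increment_le]
    passes to increments, and [le_young_inf] removes [k]. *)
Lemma increment_le_hoelder (R : realType) (E dE X Y M m : R -> R)
    (a b p q : R) :
  a < b -> 0 < p -> 0 < q -> p^-1 + q^-1 = 1 ->
  {within `[a, b], continuous E} ->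
  {within `[a, b], continuous M} ->
  {within `[a, b], continuous (fun s => X s `^ p)} ->
  (forall s, a < s < b -> is_derive s 1 E (dE s)) ->
  (forall s, a < s < b -> is_derive s 1 M (m s)) ->
  (forall s, a < s < b ->
    [/\ 0 <= X s, 0 <= Y s, `|dE s| <= X s * Y s & Y s `^ q <= m s]) ->
  `|E b - E a| <=
    (\int[lebesgue_measure]_(s in `[a, b]) (X s `^ p)) `^ p^-1
    * (M b - M a) `^ q^-1.
Proof.
move=> ab p0 q0 pq cE cM cX hE hM H.
pose P y := \int[lebesgue_measure]_(t in `[a, y]) (X t `^ p).
have Pa : P a = 0 by rewrite /P set_itv1 Rintegral_set1.
have cP : {within `[a, b], continuous P}.
  by apply: within_continuous_primitive => //; exact: ltW.
have hP s : a < s < b -> is_derive s 1 P (X s `^ p).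
  by move=> sab; exact: is_derive_primitive cX.
rewrite -/(P b); apply: le_young_inf => //.
- by apply: Rintegral_ge0 => x _; exact: powR_ge0.
(* [M b - M a] is nonnegative by comparison with the zero function, since [m] dominates [Y ^ q]. *)
- have c0 : {within `[a, b], continuous (cst 0 : R -> R)}.
    by apply: continuous_subspaceT => ?; exact: cvg_cst.
  have := @increment_le _ (cst 0) M (cst 0) m _ _ ab c0 cM _ hM _.
  move=> h; apply: le_trans (h _ _) => //.
  move=> s /H[_ _ _ mge]; rewrite normr0.
  by apply: le_trans mge; exact: powR_ge0.
move=> k k0.
pose N : R -> R := ((k `^ p / p) \*: P) + ((k^-1 `^ q / q) \*: M).
suff : `|E b - E a| <= N b - N a.
  have -> : N b - N a = k `^ p / p * P b + k^-1 `^ q / q * M b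
      - (k `^ p / p * P a + k^-1 `^ q / q * M a) by [].
  by rewrite Pa mulr0 add0r -addrA -mulrBr.
apply: (@increment_le _ E N dE
  (fun s => k `^ p / p * X s `^ p + k^-1 `^ q / q * m s)) => //.
- apply: within_continuousD => x; apply: cvgZr; [exact: cP|exact: cM].
- move=> s sab; have hPs := hP s sab; have hMs := hM s sab.
  exact: is_deriveD.
- move=> s /H[X0 Y0 dEle mge]; apply: (le_trans dEle).
  have -> : X s * Y s = (k * X s) * (k^-1 * Y s).
    by rewrite mulrACA divff ?mul1r// gt_eqF.
  have kV0 : 0 <= k^-1 by rewrite invr_ge0 ltW.
  apply: le_trans (conjugate_powR _ _ p0 q0 pq) _;
    rewrite ?mulr_ge0 ?(ltW k0)//.
  rewrite !powRM ?(ltW k0)// mulrAC lerD2l [in leRHS]mulrAC.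
  by rewrite ler_pM2r ?invr_gt0// ler_wpM2l ?powR_ge0.
Qed.

(** * Derivatives relative to a set *)

Lemma derivable_on_within_continuous (R : realType) (I : set R) (f : R -> R)
    (x : R) :
  derivable_on I f x -> f y @[y --> within I (nbhs x)] --> f x.
Proof.
move=> /cvg_ex[/= l dfl].
have fx : f y @[y --> within I x^'] --> f x.
  have idx : (y - x) @[y --> within I x^'] --> x - x.
    apply: cvgB; last exact: cvg_cst.
    by do 2 apply: cvg_within_filter.
  have : ((f y - f x) / (y - x) * (y - x) + f x) @[y --> within I x^'] -->
      l * (x - x) + f x.
    by apply: cvgD; [exact: cvgM|exact: cvg_cst].
  rewrite subrr mulr0 add0r => h; apply: cvg_trans h; apply: near_eq_cvg.
  rewrite near_withinE /= near_withinE; near=> y => yx _ /=.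
  by rewrite divfK ?subr_eq0// subrK.
(* From the punctured neighbourhood to the full one: only [y = x] is missing, and there the value is
   [f x] itself. *)
move=> P Pfx; have H : nbhs x (fun y => y != x -> I y -> P (f y)) := fx P Pfx.
change (nbhs x (fun y => I y -> P (f y))).
apply: filterS H => y Hy Iy; have [->|yx] := eqVneq y x.
  exact: nbhs_singleton.
exact: Hy.
Unshelve. all: by end_near. Qed.

(** At an interior point, restricting the punctured filter to [I] changes nothing. The limit is then
    read off Caratheodory's slope function, which is continuous at [x] and equals the difference
    quotient elsewhere. *)
Lemma is_derive_derive_on (R : realType) (I : set R) (f : R -> R) (x : R) :
  I° x -> derivable f x 1 -> is_derive x 1 f (derive_on I f x).
Proof.
move=> Ix dfx; apply: DeriveDef => //; apply/esym.
have /is_derive1_caratheodory[g [fE cg gx]] := derivableP dfx.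
have -> : derive_on I f x = lim (((f y - f x) / (y - x)) @[y --> x^']).
  rewrite /derive_on; suff -> : within I x^' = x^' by [].
  apply/seteqP; split=> P; rewrite /within/= => H.
    have H1 : nbhs x (fun y => y != x -> I y -> P y) := H.
    change (nbhs x (fun y => y != x -> P y)).
    by apply: filterS2 H1 Ix => y H2 Iy yx; exact: H2.
  have H1 : nbhs x (fun y => y != x -> P y) := H.
  change (nbhs x (fun y => y != x -> I y -> P y)).
  by apply: filterS H1 => y H2 yx _; exact: H2.
apply: cvg_lim => //; rewrite -gx.
have : g y @[y --> x^'] --> g x by apply: cvg_within_filter; exact: cg.
move=> h; apply: cvg_trans h; apply: near_eq_cvg.
rewrite near_withinE; near=> y => yx /=.
by rewrite fE mulfK// subr_eq0.
Unshelve. all: by end_near. Qed.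

(** * The harmonic path between two points *)

(** A weighted harmonic mean: for nonzero [u] and [v] its reciprocal is [s / u + (1 - s) / v], so it
    runs from [v] at 0 through the harmonic mean at 1/2 to [u] at 1. *)
Definition harmonic_path (R : realType) (u v s : R) : R :=
  u * v / (s * v + (1 - s) * u).

Lemma harmonic_path0 (R : realType) (u v : R) :
  u != 0 -> harmonic_path u v 0 = v.
Proof. by move=> u0; rewrite /harmonic_path; field. Qed.

Lemma harmonic_path_half (R : realType) (u v : R) :
  0 < u -> 0 < v -> harmonic_path u v (1 / 2) = 2 * u * v / (u + v).
Proof.
move=> u0 v0; rewrite /harmonic_path; field.
by rewrite addrC !gt_eqF//; lra.
Qed.

Lemma affine_gt0 (R : realType) (u v s : R) :
  0 < u -> 0 < v -> 0 <= s <= 1 -> 0 < s * v + (1 - s) * u.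
Proof. by move=> u0 v0 /andP[s0 s1]; nra. Qed.

(** With [A = s v + (1 - s) u], one has [u v - a A = s v (u - a) + (1 - s) u (v - a)] and [b A - u v
    = s v (b - u) + (1 - s) u (b - v)], all terms being nonnegative. *)
Lemma harmonic_path_in (R : realType) (a b u v s : R) :
  0 < a -> a <= u <= b -> a <= v <= b -> 0 <= s <= 1 ->
  a <= harmonic_path u v s <= b.
Proof.
move=> a0 /andP[au ub] /andP[av vb] /[dup] s01 /andP[s0 s1].
have u0 := lt_le_trans a0 au; have v0 := lt_le_trans a0 av.
have A0 := affine_gt0 u0 v0 s01.
rewrite /harmonic_path ler_pdivlMr// ler_pdivrMr//.
have s1' : 0 <= 1 - s by rewrite subr_ge0.
have H (w z y : R) : 0 <= w -> 0 < z -> 0 <= y -> 0 <= w * z * y.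
  by move=> w0 z0 y0; rewrite !mulr_ge0// ltW.
apply/andP; split.
  have := H s v (u - a) s0 v0; have := H (1 - s) u (v - a) s1' u0.
  by rewrite !subr_ge0 => /(_ av) + /(_ au); lra.
have := H s v (b - u) s0 v0; have := H (1 - s) u (b - v) s1' u0.
by rewrite !subr_ge0 => /(_ vb) + /(_ ub); lra.
Qed.

(** In the identities behind [harmonic_path_in], [u != v] makes one term of each sum positive.
    Strictness is wanted because [f] and the primitive [G] are differentiated only inside []a,
    b[]. *)
Lemma harmonic_path_in_open (R : realType) (a b u v s : R) :
  0 < a -> a <= u <= b -> a <= v <= b -> u != v -> 0 < s < 1 ->
  a < harmonic_path u v s < b.
Proof.
move=> a0 /andP[au ub] /andP[av vb] uv /andP[s0 s1].
have u0 := lt_le_trans a0 au; have v0 := lt_le_trans a0 av.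
have A0 : 0 < s * v + (1 - s) * u by apply: affine_gt0; rewrite ?ltW.
rewrite /harmonic_path ltr_pdivlMr// ltr_pdivrMr//.
have s1' : 0 < 1 - s by rewrite subr_gt0.
have H (w z y : R) : 0 < w -> 0 < z -> 0 <= y -> 0 <= w * z * y.
  by move=> w0 z0 y0; rewrite !mulr_ge0// ltW.
have au' : 0 <= u - a by rewrite subr_ge0.
have av' : 0 <= v - a by rewrite subr_ge0.
have ub' : 0 <= b - u by rewrite subr_ge0.
have vb' : 0 <= b - v by rewrite subr_ge0.
have H' (w z y : R) : 0 < w -> 0 < z -> 0 < y -> 0 < w * z * y.
  by move=> w0 z0 y0; rewrite !mulr_gt0.
case: (ltgtP u v) uv => // uv _; apply/andP; split.
- have va : 0 < v - a by rewrite subr_gt0; exact: le_lt_trans uv.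
  have := H s v (u - a) s0 v0 au'; have := H' (1 - s) u (v - a) s1' u0 va; lra.
- have bu : 0 < b - u by rewrite subr_gt0; exact: lt_le_trans vb.
  have := H' s v (b - u) s0 v0 bu; have := H (1 - s) u (b - v) s1' u0 vb'; lra.
- have ua : 0 < u - a by rewrite subr_gt0; exact: le_lt_trans uv.
  have := H' s v (u - a) s0 v0 ua; have := H (1 - s) u (v - a) s1' u0 av'; lra.
- have bv : 0 < b - v by rewrite subr_gt0; exact: lt_le_trans ub.
  have := H s v (b - u) s0 v0 ub'; have := H' (1 - s) u (b - v) s1' u0 bv; lra.
Qed.

Lemma is_derive_affine (R : realType) (u v s : R) :
  is_derive s 1 (fun t : R => t * v + (1 - t) * u) (v - u).
Proof.
have -> : (fun t : R => t * v + (1 - t) * u) = (cst u + (v - u) \*: id).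
  by apply/funext => t; transitivity (u + (v - u) * t); [ring|].
by apply: is_derive_eq; transitivity (0 + (v - u) * 1); [|ring].
Qed.

Lemma is_derive_harmonic_path (R : realType) (u v s : R) :
  0 < u -> 0 < v -> 0 <= s <= 1 ->
  is_derive s 1 (harmonic_path u v)
    (- (u * v * (v - u)) / (s * v + (1 - s) * u) ^+ 2).
Proof.
move=> u0 v0 s01; have A0 := affine_gt0 u0 v0 s01.
have -> : harmonic_path u v =
    (u * v) \*: (fun t : R => (t * v + (1 - t) * u)^-1) by [].
have hV : is_derive s 1 (fun t : R => (t * v + (1 - t) * u)^-1)
    (- (s * v + (1 - s) * u) ^- 2 *: (v - u)).
  apply: (@is_deriveV _ (fun t : R => (t * v + (1 - t) * u))).
    by rewrite gt_eqF.
  exact: is_derive_affine.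
apply: is_derive_eq.
transitivity (u * v * (- (s * v + (1 - s) * u) ^- 2 * (v - u))); first by [].
field.
by rewrite gt_eqF.
Qed.

(** * The estimate on one half of the interval *)

(** Puts the integrand in the form [X ^ p] produced by [increment_le_hoelder]; positivity of the
    affine denominator allows merging the exponents. *)
Lemma C1_kernelE (R : realType) (lam p u v : R) : 0 < u -> 0 < v ->
  C1 lam p u v = \int[lebesgue_measure]_(s in `[0, 1 / 2])
    ((`|lam - 2 * s| / (s * v + (1 - s) * u) ^+ 2) `^ p).
Proof.
move=> u0 v0; apply: eq_Rintegral => s; rewrite inE/= in_itv/= => /andP[s0 s1].
have A0 : 0 < s * v + (1 - s) * u by apply: affine_gt0 => //; apply/andP; lra.
rewrite powRM ?normr_ge0 ?invr_ge0 ?exprn_ge0 ?(ltW A0)//; congr (_ * _).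
rewrite powRrM powR_mulrn ?(ltW A0)// -powRN -[- p]mulN1r powRrM powR_inv1//.
by rewrite exprn_ge0// ltW.
Qed.

(** The quantity bounded is [E 0 - E (1/2)], as the path goes from [v] to the harmonic mean. The
    factor [(al + be) / 4] is the integral of [2 s al + (1 - 2 s) be] over [[0, 1/2]]. *)
Lemma harmonic_half_bound (R : realType) (f f' G : R -> R)
    (lam p q a b u v al be : R) :
  0 < a -> a <= u <= b -> a <= v <= b -> u != v ->
  0 < p -> 0 < q -> p^-1 + q^-1 = 1 ->
  {within `[a, b], continuous f} -> {within `[a, b], continuous G} ->
  (forall x, a < x < b -> is_derive x 1 f (f' x)) ->
  (forall x, a < x < b -> is_derive x 1 G (f x / x ^+ 2)) ->
  (forall s, 0 < s < 1 / 2 ->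
    `|f' (harmonic_path u v s)| `^ q <= 2 * s * al + (1 - 2 * s) * be) ->
  `|(lam * f v + (1 - lam) * f (2 * u * v / (u + v))) / (u * v * (v - u))
    - 2 / (v - u) ^+ 2 * (G v - G (2 * u * v / (u + v)))|
  <= C1 lam p u v `^ p^-1 * ((al + be) / 4) `^ q^-1.
Proof.
move=> a0 uab vab uv p0 q0 pq cf cG df dG Hle; set h := 2 * u * v / (u + v).
have u0 : 0 < u by case/andP: uab => au _; exact: lt_le_trans au.
have v0 : 0 < v by case/andP: vab => av _; exact: lt_le_trans av.
have vu0 : v - u != 0 by rewrite subr_eq0 eq_sym.
have uvn0 : u * v * (v - u) != 0 by rewrite !mulf_neq0// gt_eqF.
pose phi := harmonic_path u v.
have phi0 : phi 0 = v by apply: harmonic_path0; rewrite gt_eqF.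
have phih : phi (1 / 2) = h by exact: harmonic_path_half.
have h01 (s : R) : 0 <= s <= 1 / 2 -> 0 <= s <= 1.
  by move=> /andP[s0 s1]; apply/andP; lra.
have o01 (s : R) : 0 < s < 1 / 2 -> 0 < s < 1.
  by move=> /andP[s0 s1]; apply/andP; lra.
have A0 (s : R) : 0 <= s <= 1 / 2 -> 0 < s * v + (1 - s) * u.
  by move=> /h01; exact: affine_gt0.
have oc (s : R) : 0 < s < 1 / 2 -> 0 <= s <= 1 / 2.
  by move=> /andP[s0 s1]; rewrite !ltW.
have dphi (s : R) : 0 <= s <= 1 / 2 -> is_derive s 1 phi
    (- (u * v * (v - u)) / (s * v + (1 - s) * u) ^+ 2).
  by move=> /h01; exact: is_derive_harmonic_path.
have cphi : {within `[0, 1 / 2 : R], continuous phi}.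
  apply: derivable_within_continuous => s; rewrite in_itv/= => s01.
  by have := dphi s s01; case.
have phiab (s : R) : `[0, 1 / 2 : R]%classic s -> `[a, b]%classic (phi s).
  by rewrite /= !in_itv/= => /h01 s01; exact: harmonic_path_in.
have cfphi := within_continuous_comp_in phiab cphi cf.
have cGphi := within_continuous_comp_in phiab cphi cG.
have caff : continuous (fun s : R => lam - 2 * s).
  by move=> s; apply: cvgB; [exact: cvg_cst|apply: cvgMr; exact: cvg_id].
(* The coefficient of [G] is forced: as [phi' / phi ^ 2 = - (v - u) / (u v)], its term contributes
   [2 f(phi) / (u v (v - u))], cancelling what the derivative of [lam - 2 s] leaves. *)
pose E (s : R) : R := (u * v * (v - u))^-1 * ((lam - 2 * s) * f (phi s))
  - 2 / (v - u) ^+ 2 * G (phi s).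
pose X (s : R) : R := `|lam - 2 * s| / (s * v + (1 - s) * u) ^+ 2.
pose M (s : R) : R := s ^+ 2 * al + (s - s ^+ 2) * be.
pose dE (s : R) : R :=
  - (lam - 2 * s) / (s * v + (1 - s) * u) ^+ 2 * f' (phi s).
have cE : {within `[0, 1 / 2], continuous E}.
  apply: within_continuousB => s.
    apply: cvgMr; apply: cvgM; [|exact: cfphi].
    by move: s; exact: continuous_subspaceT.
  by apply: cvgMr; exact: cGphi.
have cM : {within `[0, 1 / 2], continuous M}.
  apply: continuous_subspaceT => s.
  apply: cvgD; apply: cvgMl; [exact: exprn_continuous|].
  by apply: cvgB; [exact: cvg_id|exact: exprn_continuous].
have cX : {within `[0, 1 / 2], continuous (fun s => X s `^ p)}.
  have -> : (fun s => X s `^ p) = (fun s => `|X s| `^ p).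
    apply/funext => s; rewrite ger0_norm// /X.
    by rewrite mulr_ge0// invr_ge0 sqr_ge0.
  apply: continuous_subspace_itv => s; rewrite in_itv/= => s01.
  apply: (@continuous_comp _ _ _ X (fun y => `|y| `^ p)); last first.
    exact: continuous_normr_powR.
  apply: cvgM; first by apply: cvg_norm; exact: caff.
  apply: cvgV; first by rewrite expf_neq0// gt_eqF// A0.
  have cA : {for s, continuous (fun s : R => s * v + (1 - s) * u)}.
    have [/derivable1_diffP dA _] := is_derive_affine u v s.
    exact: differentiable_continuous.
  exact: (continuous_comp cA (@exprn_continuous _ 2%N _)).
have hE (s : R) : 0 < s < 1 / 2 -> is_derive s 1 E (dE s).
  move=> s01; have s01c := oc _ s01.
  have phis : a < phi s < b by apply: harmonic_path_in_open => //; exact: o01.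
  have dps := dphi s s01c.
  have h1 := is_derive1_comp (df _ phis) dps.
  have h2 := is_derive1_comp (dG _ phis) dps.
  have h3 : is_derive s 1 (fun s : R => lam - 2 * s) (- 2).
    apply: (@is_derive_eq _ _ _ (cst lam - 2 \*: id)).
    by transitivity (0 - 2 * 1 : R); [|ring].
  have := is_deriveB (is_deriveZ (u * v * (v - u))^-1 (is_deriveM h3 h1))
    (is_deriveZ (2 / (v - u) ^+ 2) h2).
  move=> h4; apply: (is_derive_eq h4).
  transitivity ((u * v * (v - u))^-1 *
     ((lam - 2 * s) * (f' (phi s) *
       (- (u * v * (v - u)) / (s * v + (1 - s) * u) ^+ 2))
      + f (phi s) * (- 2))
     - (2 / (v - u) ^+ 2) * (f (phi s) / phi s ^+ 2 *
       (- (u * v * (v - u)) / (s * v + (1 - s) * u) ^+ 2))); first by [].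
  rewrite /dE; have Ephi : phi s = u * v / (s * v + (1 - s) * u) by [].
  move: (f (phi s)) (f' (phi s)) => fs f's; rewrite Ephi.
  field.
  by rewrite vu0 (gt_eqF (A0 _ s01c)) !gt_eqF.
have hM (s : R) : 0 < s < 1 / 2 ->
    is_derive s 1 M (2 * s * al + (1 - 2 * s) * be).
  move=> s01.
  have h1 : is_derive s 1 (fun s : R => s ^+ 2) (2 * s).
    have := @is_deriveM _ _ id id s 1 _ _ (is_derive_id s 1) (is_derive_id s 1).
    move=> hid; apply: (is_derive_eq hid).
    by transitivity (s * 1 + s * 1); [|ring].
  have -> : M = al \*: (fun s : R => s ^+ 2)
      + be \*: (id - (fun s : R => s ^+ 2)).
    by apply/funext => t; rewrite /M mulrC [X in _ + X]mulrC.
  apply: is_derive_eq.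
  by transitivity (al * (2 * s) + be * (1 - 2 * s)); [|ring].
have HXY (s : R) : 0 < s < 1 / 2 -> [/\ 0 <= X s, 0 <= `|f' (phi s)|,
    `|dE s| <= X s * `|f' (phi s)|
    & `|f' (phi s)| `^ q <= 2 * s * al + (1 - 2 * s) * be].
  move=> s01; have s01c := oc _ s01; split => //.
  - by rewrite divr_ge0// exprn_ge0// ltW// A0.
  - rewrite /X /dE !normrM normrN normfV [`|_ ^+ 2|]ger0_norm//.
    by rewrite exprn_ge0// ltW// A0.
  - exact: Hle.
have half0 : 0 < 1 / 2 :> R by rewrite divr_gt0.
have := increment_le_hoelder half0 p0 q0 pq cE cM cX hE hM HXY.
rewrite C1_kernelE//.
have -> : M (1 / 2) - M 0 = (al + be) / 4 by rewrite /M; field.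
rewrite /E phi0 phih; apply: le_trans; rewrite -normrN.
rewrite le_eqVlt; apply/orP; left; apply/eqP; congr `|_|; field.
by rewrite vu0 !gt_eqF.
Qed.

(** * Combining the two halves *)

Unset Implicit Arguments.

Theorem theorem6 (R : realType) (I : set R) (f : R -> R) (a b p q : R)
  (I_itv : is_interval I)
  (I_pos : I `<=` `]0, +oo[)
  (f_diff : forall x : R, (I°) x -> derivable f x 1)
  (Ia : I a) (Ib : I b) (ab : a < b)
  (f_diff_ab : forall x : R, a <= x <= b -> derivable_on I f x)
  (df_L : lebesgue_measure.-integrable `[a, b] (fun x => (derive_on I f x)%:E))
  (q1 : 1 < q) (pq : 1 / p + 1 / q = 1)
  (hconv : harmonically_convex `[a, b] (fun x => `|derive_on I f x| `^ q)) :
  forall lam : R, 0 <= lam <= 1 ->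
  let h := 2 * a * b / (a + b) in
  `| (1 - lam) * f h + lam * ((f a + f b) / 2)
     - a * b / (b - a) * \int[lebesgue_measure]_(x in `[a, b]) (f x / x ^+ 2) |
  <= a * b * (b - a) / 2 *
     (C1 lam p a b `^ (1 / p) *
        ((`|derive_on I f h| `^ q + `|derive_on I f b| `^ q) / 4) `^ (1 / q)
      + C1 lam p b a `^ (1 / p) *
        ((`|derive_on I f h| `^ q + `|derive_on I f a| `^ q) / 4) `^ (1 / q)).
Proof.
move=> lam _; cbv zeta; rewrite !div1r in pq *; set h := 2 * a * b / (a + b).
have a0 : 0 < a by have := I_pos _ Ia; rewrite /= in_itv/= andbT.
have b0 : 0 < b by exact: lt_trans ab.
have q0 : 0 < q by exact: lt_trans q1.
have qV1 : q^-1 < 1 by rewrite invf_lt1.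
have p0 : 0 < p by rewrite -invr_gt0; lra.
have sub_cc : `[a, b]%classic `<=` I.
  by move=> x; rewrite /= in_itv/=; exact: I_itv.
have df x : a < x < b -> is_derive x 1 f (derive_on I f x).
  move=> xab; have Ix : I° x.
    have : nbhs x `]a, b[%classic by exact: near_in_itvoo.
    by apply: filterS => y /= yab; apply: sub_cc; exact: subset_itv_oo_cc.
  by apply: is_derive_derive_on => //; exact: f_diff.
have cf : {within `[a, b], continuous f}.
  apply/subspace_continuousP => x /=; rewrite in_itv/= => xab.
  (* The derivative relative to [I] also covers [a] and [b] when they are endpoints of [I];
     continuity then restricts to the subset [[a, b]]. *)
  have cIf := derivable_on_within_continuous (f_diff_ab _ xab).
  move=> P /cIf H; have H1 : nbhs x (fun y => I y -> P (f y)) := H.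
  change (nbhs x (fun y => `[a, b]%classic y -> P (f y))).
  by apply: filterS H1 => y Hy /sub_cc; exact: Hy.
pose G y := \int[lebesgue_measure]_(x in `[a, y]) (f x / x ^+ 2).
have cg : {within `[a, b], continuous (fun x => f x / x ^+ 2)}.
  apply: within_continuousM => //.
  apply: continuous_subspace_itv => x; rewrite in_itv/= => /andP[ax _].
  apply: cvgV; last exact: exprn_continuous.
  by rewrite expf_neq0// gt_eqF// (lt_le_trans a0 ax).
have cG : {within `[a, b], continuous G}.
  by apply: within_continuous_primitive => //; exact: ltW.
have dG x : a < x < b -> is_derive x 1 G (f x / x ^+ 2).
  by move=> xab; exact: is_derive_primitive cg.
have Ga : G a = 0 by rewrite /G set_itv1 Rintegral_set1.
have aab : a <= a <= b by rewrite lexx ltW.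
have bab : a <= b <= b by rewrite lexx ltW.
have hab : a <= h <= b.
  rewrite /h -(harmonic_path_half a0 b0); apply: harmonic_path_in => //.
  by apply/andP; lra.
have hle u v s : a <= u <= b -> a <= v <= b -> 2 * u * v / (u + v) = h ->
    0 < s < 1 / 2 -> `|derive_on I f (harmonic_path u v s)| `^ q <=
    2 * s * `|derive_on I f h| `^ q + (1 - 2 * s) * `|derive_on I f v| `^ q.
  move=> uab vab uvh /andP[s0 s1].
  have u0 : 0 < u by case/andP: uab => au _; exact: lt_le_trans au.
  have v0 : 0 < v by case/andP: vab => av _; exact: lt_le_trans av.
  (* The path from [v] to [h] at parameter [2 s] is the path from [v] to [u] at parameter [s],
     because [1 / h] is the midpoint of [1 / u] and [1 / v]. *)
  case: hconv => _ _ /(_ v h (2 * s)).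
  rewrite /= !in_itv/= => /(_ vab hab).
  suff -> : v * h / (2 * s * v + (1 - 2 * s) * h) = harmonic_path u v s.
    by apply; apply/andP; lra.
  have A0 : 0 < s * v + (1 - s) * u by apply: affine_gt0 => //; apply/andP; lra.
  rewrite /harmonic_path -uvh; field.
  have -> : 2 * s * v * (u + v) + (1 - 2 * s) * (2 * u * v) =
      2 * v * (s * v + (1 - s) * u) by ring.
  by rewrite !mulf_neq0 ?(gt_eqF A0) ?(gt_eqF v0) ?(gt_eqF (addr_gt0 u0 v0)).
have a_neq_b : a != b by rewrite lt_eqF.
have b_neq_a : b != a by rewrite gt_eqF.
have Hb := harmonic_half_bound lam a0 aab bab a_neq_b p0 q0 pq cf cG df dG
  (fun s => hle a b s aab bab erefl).
have hba : 2 * b * a / (b + a) = h by rewrite /h (addrC b) (mulrAC 2 b).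
have Ha := harmonic_half_bound lam a0 bab aab b_neq_a p0 q0 pq cf cG df dG
  (fun s => hle b a s bab aab hba).
rewrite -/h in Hb; rewrite hba Ga in Ha; rewrite -/(G b).
have K0 : 0 <= a * b * (b - a) / 2.
  by rewrite divr_ge0// !mulr_ge0 ?subr_ge0// ltW.
apply: le_trans (ler_wpM2l K0 (lerD Hb Ha)).
(* Swapping [a] and [b] flips the sign of [v - u], so the two bounded quantities are subtracted: the
   [f] terms then add up, [G h] cancels, and [G a = 0] leaves the full integral [G b]. *)
apply: le_trans (ler_wpM2l K0 (ler_normB _ _)).
rewrite -{1}(ger0_norm K0) -normrM.
rewrite le_eqVlt; apply/orP; left; apply/eqP; congr `|_|.
move: (f h) (f a) (f b) (G h) (G b) => fh fa fb Gh Gb; field.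
by rewrite subr_eq0 a_neq_b !gt_eqF ?subr_gt0.
Qed.
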